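(* Let $(W_{i,j})_{i\ge 1,\,0\le j\le N}$ be nonnegative integers with $\sum_i W_{i,j}<\infty$ for each $j$, and for each $j$ let $w_j$ be the one-rowed array consisting of $W_{1,j}$ copies of $1$, $W_{2,j}$ copies of $2$, $\dots$ (in weakly increasing order). Let $(L_{i,j})$ be the image of $(W_{i,j})$ under the tropicalization of the map $(V_{i,j})\mapsto (U_{i,j})$ defined by $$F(V_N)\cdots F(V_1)F(V_0)=F_{N+1}(U_{N+1})\cdots F_2(U_2)F_1(U_1).$$ Then, for $N$ sufficiently large, for all $i,j$ the number of entries equal to $i$ in the $j$-th row of the circled array $w_N\leftharpoonup w_{N-1}\leftharpoonup\cdots\leftharpoonup w_0$ equals $L_{i,j}$.
   Context: Let $M$ be the semifield of germs at $\epsilon=0$ of continuous positive functions $f(\epsilon)$, $\epsilon>0$, with $\lim_{\epsilon\to+0}\epsilon\log f(\epsilon)\in\mathbb{R}$, with usual $+,\cdot,{}^{-1}$, and let $\overline{f}=-\lim_{\epsilon\to+0}\epsilon\log f(\epsilon)$; this is a morphism $M\to\mathbb{R}$ sending $+$ to $\min$, $\cdot$ to $+$, ${}^{-1}$ to negation. For an infinite vector $V=(V_1,V_2,\dots)$, $F(V)$ is the infinite lower bidiagonal matrix with $1$ on the diagonal and $-V_1,-V_2,\dots$ on the subdiagonal, and $F_k(V)=\mathrm{diag}(\mathrm{Id}_{k-1},F(V))$. For vectors $V_j=(V_{1,j},V_{2,j},\dots)$, $j=0,\dots,N$, with entries in $M$, the vectors $U_j=(U_{1,j},U_{2,j},\dots)$,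 $j=1,\dots,N+1$, are uniquely determined by the displayed matrix equation and each $U_{i,j}$ is a subtraction-free rational expression in the $V$'s; the tropicalization is the piecewise-linear map $(W_{i,j})\mapsto(L_{i,j})$ obtained by replacing $+,\cdot,{}^{-1}$ by $\min,+,-$ in these expressions, i.e. $L_{i,j}=\overline{U_{i,j}}$ whenever $W_{i,j}=\overline{V_{i,j}}$. A circled array is a finite list of rows (row $1$, row $2$, $\dots$), each a finite weakly increasing sequence of positive integers regarded as circled numbers (empty rows allowed). A one-rowed array is a finite weakly increasing sequence of positive integers (boxed numbers). The action $C\leftharpoonup x$ of a one-rowed array $x$ on a circled array $C$ with rows $C_1,\dots,C_r$: put $x^{(1)}=x$; for $p=1,\dots,r$, list the circled entries of $C_p$ and the boxed entries of $x^{(p)}$ as a sequence of cells in the order: circled $1$'s, boxed $1$'s, circled $2$'s, boxed $2$'s, $\dots$. Regard circled cells as cells containing a ball and boxed cells as empty cells and perform one step of the Takahashi–Satsuma box-ball system: balls are moved one at a time from left to right, each to the nearest cell to its right that was originally empty and is not yet occupied by a moved ball; a ball with no such cell is discarded. Then each cell originally containing a ball becomes a boxed cell with its number decreased by one, each originally empty cell receiving a ball becomes a circled cell with the same number, other cells are unchanged, and boxed cells with number $0$ are deleted. The circled numbers, in order, form the new row $p$, and the boxed numbers, in order, form $x^{(p+1)}$. Finally $x^{(r+1)}$ is appended as a new last row (circled). For one-rowed arrays $x_1,\dots,x_n$, $x_1\leftharpoonup x_2\leftharpoonup\cdots\leftharpoonup x_n$ denotes the circled array obtained by acting successively with $x_1$,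 then $x_2$, $\dots$, then $x_n$ on the array with no rows. *)

(* Defs.v *)
From HB Require Import structures.
From mathcomp Require Import all_boot all_order all_algebra.
From mathcomp Require Import all_classical all_reals all_analysis.
Set Implicit Arguments. Unset Strict Implicit. Unset Printing Implicit Defensive.
Import Order.TTheory GRing.Theory Num.Theory.

(* one-rowed array w_j : W 1 j copies of 1, W 2 j copies of 2, ...,
   given a bound b with W i j = 0 for i > b. *)
Definition one_row (W : nat -> nat -> nat) (b : nat) (j : nat) : seq nat :=
  flatten [seq nseq (W i j) i | i <- iota 1 b].

(* A cell: (true, n) = circled n (contains a ball); (false, n) = boxed n (empty). *)
Definition cells_of (C x : seq nat) : seq (bool * nat) :=
  let m := foldr maxn 0 (C ++ x) in
  flatten [seq nseq (count_mem k C) (true, k) ++ nseq (count_mem k x) (false, k)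
          | k <- iota 1 m].

Definition avail (cs : seq (bool * nat)) (filled : seq bool) (pos q : nat) : bool :=
  [&& pos < q, q < size cs, ~~ (nth (false, 0) cs q).1 & ~~ nth false filled q].

Definition move_ball (cs : seq (bool * nat)) (filled : seq bool) (pos : nat) : seq bool :=
  match [seq q <- iota 0 (size cs) | avail cs filled pos q] with
  | q :: _ => set_nth false filled q true
  | [::] => filled
  end.

Definition bbs_filled (cs : seq (bool * nat)) : seq bool :=
  foldl (move_ball cs) (nseq (size cs) false)
        [seq p <- iota 0 (size cs) | (nth (false, 0) cs p).1].

(* one box-ball step on row C_p with boxed entries x^(p):
   returns (new row p, x^(p+1)) *)
Definition bbs_step (C x : seq nat) : seq nat * seq nat :=
  let cs := cells_of C x in
  let f := bbs_filled cs in
  let idx := iota 0 (size cs) in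
  ([seq (nth (false, 0) cs q).2 | q <- idx &
        ~~ (nth (false, 0) cs q).1 && nth false f q],
   [seq (if (nth (false, 0) cs q).1 then (nth (false, 0) cs q).2 - 1
         else (nth (false, 0) cs q).2)
   | q <- idx &
        (if (nth (false, 0) cs q).1 then (nth (false, 0) cs q).2 - 1 != 0
         else ~~ nth false f q)]).

Fixpoint act (C : seq (seq nat)) (x : seq nat) : seq (seq nat) :=
  match C with
  | [::] => [:: x]
  | r :: C' => let p := bbs_step r x in p.1 :: act C' p.2
  end.

Definition act_all (xs : seq (seq nat)) : seq (seq nat) := foldl act [::] xs.

Definition circled_array (W : nat -> nat -> nat) (b : nat -> nat) (N : nat) :=
  act_all [seq one_row W (b j) j | j <- rev (iota 0 N.+1)].

(* Real side: infinite lower-triangular matrices, indices a, b >= 1     *)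

Local Open Scope ring_scope.

Definition infmx (R : realType) := nat -> nat -> R.

(* product of (lower triangular) infinite matrices: entries A a c vanish
   for c > a, so the sum over c is finite *)
Definition mulinf (R : realType) (A B : infmx R) : infmx R :=
  fun a b => \sum_(1 <= c < a.+1) A a c * B c b.

Definition idinf (R : realType) : infmx R := fun a b => (a == b)%:R.

Definition prodinf (R : realType) (l : seq (infmx R)) : infmx R :=
  foldr (@mulinf R) (@idinf R) l.

Definition Fmx (R : realType) (V : nat -> R) : infmx R :=
  fun a b => if a == b then 1 else if a == b.+1 then - V b else 0.

(* F_k(V) = diag(Id_{k-1}, F(V)) *)
Definition Fkmx (R : realType) (k : nat) (V : nat -> R) : infmx R :=
  fun a b => if (a < k)%N || (b < k)%N then (a == b)%:R
             else Fmx V (a - k).+1 (b - k).+1.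

(* Main.v *)
Require Import Defs.
From HB Require Import structures.
From mathcomp Require Import all_boot all_order all_algebra.
From mathcomp Require Import all_classical all_reals all_analysis.
From mathcomp Require Import zify ring lra.
Set Implicit Arguments. Unset Strict Implicit. Unset Printing Implicit Defensive.
Import Order.TTheory GRing.Theory Num.Theory.
Import numFieldNormedType.Exports.

(* The relation F(Y) F(X) = F_2(X') F_1(Y') is solved without subtraction by the
   discrete Toda recursion
     Z_1 = Y_1,  Z_{i+1} = Y_{i+1} Z_i / (X_i + Z_i),
     Y'_i = X_i + Z_i,  X'_i = Y_{i+1} X_i / (X_i + Z_i).
   Moving the factors F(V_{N-1}), ..., F(V_0) in turn through the rows obtained
   so far produces the right-hand factorization, and this factorization is
   unique as soon as the U's do not vanish. The tropicalization of the recursion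
   is one box-ball step: Z_i becomes the number of balls carried just after the
   circled i's have been picked up, Y'_i = min(X_i, Z_i) the number of boxed i's
   that receive a ball, and X'_i the number of i's among the remaining boxes. *)

(** * Multiplicities after one box-ball step *)

Definition balls (cs : seq (bool * nat)) := count (fun e => e.1) cs.

Lemma balls_rcons cs e : balls (rcons cs e) = balls cs + e.1.
Proof. by rewrite /balls -cats1 count_cat /= addn0. Qed.

Lemma count_set_nth (s : seq bool) q :
  q < size s -> ~~ nth false s q -> count id (set_nth false s q true) = (count id s).+1.
Proof.
move=> qs nq; rewrite set_nthE qs -cat_rcons count_cat -cats1 count_cat /=.
rewrite -[in RHS](cat_take_drop q s) count_cat (drop_nth false qs) /= (negbTE nq); lia.
Qed.

Lemma size_move_ball cs s p : size s = size cs -> size (move_ball cs s p) = size cs.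
Proof.
move=> ss; rewrite /move_ball; case E: [seq _ <- _ | _] => [//|q l].
have: q \in q :: l by rewrite mem_head.
rewrite -E mem_filter => /andP[/and4P[_ qs _ _] _].
by rewrite size_set_nth ss; apply/maxn_idPr.
Qed.

Lemma size_foldl_move_ball cs s ps : size s = size cs ->
  size (foldl (move_ball cs) s ps) = size cs.
Proof. by elim: ps s => //= p ps IH s ss; rewrite IH ?size_move_ball. Qed.

(** A ball takes the leftmost free cell, so it reaches the appended cell only when it finds no place
    in [cs]. A move inside [cs] raises the number of filled cells by one, so an unchanged count
    detects this failure. *)
Lemma move_ball_rcons cs e s f p : size s = size cs -> p < size cs ->
  move_ball (rcons cs e) (rcons s f) p =
    rcons (move_ball cs s p)
      (f || (~~ e.1 && (count id (move_ball cs s p) == count id s))) /\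
  (count id (move_ball cs s p) = count id s \/
   count id (move_ball cs s p) = (count id s).+1).
Proof.
move=> ss pc; rewrite /move_ball size_rcons -[(size cs).+1]addn1 iotaD add0n.
rewrite filter_cat.
have -> : [seq q <- iota 0 (size cs) | avail (rcons cs e) (rcons s f) p q] =
          [seq q <- iota 0 (size cs) | avail cs s p q].
  apply: eq_in_filter => q; rewrite mem_iota add0n => /andP[_ qc].
  by rewrite /avail size_rcons !nth_rcons ss qc (ltn_trans qc).
case E: [seq q <- iota 0 (size cs) | _] => [|q l] /=.
  split; last by left.
  rewrite /avail size_rcons pc ltnSn !nth_rcons ss ltnn eqxx /=.
  case: e.1 => /=; first by rewrite orbF.
  case: f => //=; rewrite eqxx -ss.
  by elim: s {ss E} => //= a s ->.
have: q \in q :: l by rewrite mem_head.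
rewrite -E mem_filter => /andP[/and4P[_ qs _ nq] _].
rewrite count_set_nth ?ss //; split; last by right.
rewrite (_ : _.+1 == _ = false); last by lia.
rewrite andbF orbF; have qs' : q < size s by rewrite ss.
elim: s q qs' {ss E nq qs} => //= a s IH [|q] //= qs; rewrite IH //.
Qed.

(** The appended box is filled as soon as one move fails inside [cs], that is, when fewer cells of
    [cs] were filled than balls were moved. *)
Lemma foldl_move_ball_rcons cs e s f ps : size s = size cs ->
  all (fun p => p < size cs) ps ->
  foldl (move_ball (rcons cs e)) (rcons s f) ps =
    rcons (foldl (move_ball cs) s ps)
      (f || (~~ e.1 && (count id (foldl (move_ball cs) s ps) < count id s + size ps))) /\
  count id (foldl (move_ball cs) s ps) <= count id s + size ps.
Proof.
elim: ps s f => [|p ps IH] s f ss /=.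
  by rewrite addn0 ltnn andbF orbF leqnn.
move=> /andP[pc psc]; have [-> hc] := move_ball_rcons e f ss pc.
have [-> hle] := IH _ (f || (~~ e.1 && (count id (move_ball cs s p) == count id s)))
  (size_move_ball p ss) psc.
split; last by lia.
congr rcons; case: f => //=; case: e.1 => //=.
by case: hc hle => ->; lia.
Qed.

Definition annotate cs := zip cs (bbs_filled cs).

Lemma size_bbs_filled cs : size (bbs_filled cs) = size cs.
Proof. by rewrite /bbs_filled size_foldl_move_ball ?size_nseq. Qed.

Lemma size_ball_positions cs :
  size [seq p <- iota 0 (size cs) | (nth (false, 0) cs p).1] = balls cs.
Proof.
rewrite size_filter /balls -[in RHS](mkseq_nth (false, 0) cs) count_map.
exact: eq_count.
Qed.

(* The moves of the balls of [cs] are not affected by a cell added at the right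
   end, and that cell receives the first ball which finds no place in [cs]. *)
Lemma bbs_filled_rcons cs e :
  bbs_filled (rcons cs e) =
  rcons (bbs_filled cs) (~~ e.1 && (count id (bbs_filled cs) < balls cs)).
Proof.
rewrite /bbs_filled size_rcons -[(size cs).+1]addn1 iotaD add0n filter_cat.
have -> : [seq p <- iota 0 (size cs) | (nth (false, 0) (rcons cs e) p).1] =
          [seq p <- iota 0 (size cs) | (nth (false, 0) cs p).1].
  apply: eq_in_filter => q; rewrite mem_iota add0n => /andP[_ qc].
  by rewrite nth_rcons qc.
set ps := [seq p <- iota 0 (size cs) | _]; rewrite addn1 -[in LHS]addn1 nseqD cats1.
have psc : all (fun p => p < size cs) ps.
  by apply/allP => p; rewrite mem_filter mem_iota add0n => /andP[_ /andP[]].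
have [E hle] := foldl_move_ball_rcons e false (size_nseq (size cs) false) psc.
rewrite foldl_cat E /= size_ball_positions count_nseq /= nth_rcons ltnn eqxx.
case: e.1 => //=; rewrite /move_ball.
(* If the new cell is itself a ball, it is moved last and has no cell to its right, so it is
   discarded. *)
rewrite (_ : [seq q <- _ | avail _ _ _ q] = [::]) //.
rewrite -[RHS](filter_pred0 (iota 0 (size (rcons cs e)))); apply: eq_filter => q.
by rewrite /avail size_rcons ltnS; case: ltngtP.
Qed.

Lemma annotate_rcons cs e :
  annotate (rcons cs e) =
  rcons (annotate cs) (e, ~~ e.1 && (count id (bbs_filled cs) < balls cs)).
Proof. by rewrite /annotate bbs_filled_rcons zip_rcons ?size_bbs_filled. Qed.

Lemma annotate_balls cs k n :
  [/\ annotate (cs ++ nseq n (true, k)) = annotate cs ++ nseq n ((true, k), false),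
      balls (cs ++ nseq n (true, k)) = balls cs + n &
      count id (bbs_filled (cs ++ nseq n (true, k))) = count id (bbs_filled cs)].
Proof.
elim: n => [|n [IH1 IH2 IH3]]; first by rewrite !cats0 addn0.
rewrite -addn1 !nseqD !catA !cats1 annotate_rcons bbs_filled_rcons balls_rcons.
by rewrite IH1 IH2 -!cats1 count_cat IH3 /= !addn0 addnA.
Qed.

(** Here [c] counts the balls of [cs] still in search of a place; a run of [n] boxes absorbs
    [minn n c] of them, leftmost boxes first. *)
Lemma annotate_boxes cs k n (c := balls cs - count id (bbs_filled cs)) :
  [/\ annotate (cs ++ nseq n (false, k)) =
        annotate cs ++ nseq (minn n c) ((false, k), true) ++
        nseq (n - minn n c) ((false, k), false),
      balls (cs ++ nseq n (false, k)) = balls cs &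
      count id (bbs_filled (cs ++ nseq n (false, k))) =
        count id (bbs_filled cs) + minn n c].
Proof.
elim: n => [|n [IH1 IH2 IH3]]; first by rewrite min0n !cats0 addn0.
rewrite -addn1 !nseqD !catA !cats1 annotate_rcons bbs_filled_rcons balls_rcons.
rewrite IH1 IH2 IH3 -!cats1 count_cat IH3 /= !addn0.
have [nc|cn] := ltnP n c.
  have -> : count id (bbs_filled cs) + n < balls cs by lia.
  rewrite (_ : minn (n + 1) c = n + 1); last by lia.
  by rewrite !subnn nseqD /= !cats0 -catA addnA.
have -> : (count id (bbs_filled cs) + c < balls cs) = false by lia.
rewrite (_ : minn (n + 1) c = c); last by lia.
by rewrite (_ : n + 1 - c = n - c + 1) ?nseqD ?addn0 -?catA //; lia.
Qed.

(* Number of balls in the carrier when it has just picked up the circled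
   [n.+1]'s, for [y i] circled and [x i] boxed [i]'s. *)
Fixpoint carrier (y x : nat -> nat) (n : nat) : nat :=
  if n is n'.+1 then y n'.+2 + (carrier y x n' - minn (x n'.+1) (carrier y x n'))
  else y 1.

Definition circled_out (y x : nat -> nat) (i : nat) := minn (x i) (carrier y x i.-1).
(** The circled [i.+1]'s, decreased by one, join the boxed [i]'s that received no ball. *)
Definition boxed_out (y x : nat -> nat) (i : nat) :=
  y i.+1 + (x i - minn (x i) (carrier y x i.-1)).

Definition cells_upto (y x : nat -> nat) (m : nat) :=
  flatten [seq nseq (y k) (true, k) ++ nseq (x k) (false, k) | k <- iota 1 m].

(** Induction on [m], appending a run of balls and then a run of boxes. The term [y m.+1] appears
    because the carrier is measured after the next pickup; the final inequality keeps the truncated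
    subtraction exact. *)
Lemma annotate_cells_upto y x m :
  annotate (cells_upto y x m) =
    flatten [seq nseq (y k) ((true, k), false) ++
                 nseq (circled_out y x k) ((false, k), true) ++
                 nseq (x k - circled_out y x k) ((false, k), false) | k <- iota 1 m] /\
  balls (cells_upto y x m) - count id (bbs_filled (cells_upto y x m)) + y m.+1 =
    carrier y x m /\
  count id (bbs_filled (cells_upto y x m)) <= balls (cells_upto y x m).
Proof.
elim: m => [|m]; first by rewrite /= /annotate /= /balls /=.
rewrite /cells_upto -[in iota 1 m.+1](addn1 m) iotaD !map_cat !flatten_cat /= !cats0 !add1n catA.
set cs := flatten _ => -[IH1 [IH2 IH3]].
have [A1 B1 C1] := annotate_balls cs m.+1 (y m.+1).
have [A2 B2 C2] := annotate_boxes (cs ++ nseq (y m.+1) (true, m.+1)) m.+1 (x m.+1).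
rewrite A2 B2 C2 A1 B1 C1 IH1 /=.
have E : balls cs + y m.+1 - count id (bbs_filled cs) = carrier y x m by lia.
by rewrite E /circled_out /= -!catA; split=> //; lia.
Qed.

(** Turns the position-based outputs of [bbs_step] into filters of [annotate], where runs of cells
    can be counted. *)
Lemma map_filter_nth_zip (T U V : Type) (x0 : T) (y0 : U) (s : seq T) (t : seq U)
    (P : T -> U -> bool) (g : T -> V) : size t = size s ->
  [seq g (nth x0 s q) | q <- iota 0 (size s) & P (nth x0 s q) (nth y0 t q)] =
  [seq g z.1 | z <- zip s t & P z.1 z.2].
Proof.
move=> st; have -> : zip s t = [seq (nth x0 s q, nth y0 t q) | q <- iota 0 (size s)].
  apply: (@eq_from_nth _ (x0, y0)); rewrite size_zip st minnn; first by rewrite size_map size_iota.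
  by move=> i i_s; rewrite nth_zip // (nth_map 0) ?size_iota // nth_iota.
by rewrite filter_map -map_comp.
Qed.

Lemma foldr_max_ge (s : seq nat) i : i \in s -> i <= foldr maxn 0 s.
Proof.
elim: s => //= a s IH; rewrite in_cons => /orP[/eqP->|/IH h]; lia.
Qed.

Lemma sumn_delta (f : nat -> nat) m i :
  sumn [seq (k == i) * f k | k <- iota 1 m] = if 0 < i <= m then f i else 0.
Proof.
elim: m => [|m IH]; first by case: i.
rewrite -(addn1 m) iotaD map_cat sumn_cat IH /= addn0 add1n addn1.
case: (m.+1 =P i) => [<-|im]; first by rewrite !leqnn ltnn add0n mul1n.
by rewrite mul0n addn0 (_ : (i <= m.+1) = (i <= m)) //; lia.
Qed.

Lemma count_bbs_step C x i (y := fun k => count_mem k C) (z := fun k => count_mem k x) :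
  0 < i ->
  count_mem i (bbs_step C x).1 = circled_out y z i /\
  count_mem i (bbs_step C x).2 = boxed_out y z i.
Proof.
move=> i0; rewrite /bbs_step.
rewrite (map_filter_nth_zip (false, 0) false (fun e f => ~~ e.1 && f) snd) ?size_bbs_filled //.
rewrite (map_filter_nth_zip (false, 0) false
  (fun e f => if e.1 then e.2 - 1 != 0 else ~~ f)
  (fun e => if e.1 then e.2 - 1 else e.2)) ?size_bbs_filled //=.
set m := foldr maxn 0 (C ++ x).
rewrite -/(annotate _) (_ : cells_of C x = cells_upto y z m) //.
have [-> _] := annotate_cells_upto y z m.
(* Numbers above the maximum [m] do not occur, so the formulas also hold outside the range of the
   list of cells. *)
have hm k : m < k -> y k = 0 /\ z k = 0.
  move=> mk; have : k \notin C ++ x.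
    by apply/negP => /foldr_max_ge; rewrite -/m; lia.
  rewrite mem_cat negb_or => /andP[kC kx].
  by split; apply/eqP; rewrite -leqn0 leqNgt -has_count has_pred1.
rewrite !count_map !count_filter !count_flatten -!map_comp.
split.
  rewrite (_ : map _ _ = [seq (k == i) * circled_out y z k | k <- iota 1 m]).
    rewrite sumn_delta i0 /=; case: ifPn => // /negP im.
    by rewrite /circled_out (hm i _).2 ?min0n //; lia.
  apply: eq_map => k /=; rewrite !count_cat !count_nseq /=; lia.
rewrite (_ : map _ _ = [seq (k == i.+1) * y k + (k == i) * (z k - circled_out y z k)
                        | k <- iota 1 m]).
  have sumn_add (f g : nat -> nat) s :
    sumn [seq f k + g k | k <- s] = sumn (map f s) + sumn (map g s).
    by elim: s => //= k s ->; lia.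
  rewrite sumn_add !sumn_delta /boxed_out -/(circled_out y z i) i0 /=; congr (_ + _).
    by case: ifPn => // /negP im; rewrite (hm i.+1 _).1 //; lia.
  by case: ifPn => // /negP im; rewrite (hm i _).2 //; lia.
apply: eq_map => k /=; rewrite !count_cat !count_nseq /= !andbT !andbF.
(* Deleting the boxed zeros does not affect the count of [i], since [i] is positive. *)
rewrite (_ : (k - 1 == i) && (k - 1 != 0) = (k == i.+1)); lia.
Qed.

Lemma count_one_row W b j i : 0 < i -> (forall k, b < k -> W k j = 0) ->
  count_mem i (one_row W b j) = W i j.
Proof.
move=> i0 Wb; rewrite /one_row count_flatten -map_comp.
rewrite (_ : map _ _ = [seq (k == i) * W k j | k <- iota 1 b]).
  by rewrite (sumn_delta (W ^~ j)) i0 /=; case: ifPn => // /negP ib; rewrite Wb //; lia.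
by apply: eq_map => k /=; rewrite count_nseq.
Qed.

Local Open Scope classical_set_scope.
Local Open Scope ring_scope.

(** * Tropicalization of sums, products and quotients *)

Section Tropical.
Variable R : realType.
Implicit Types f g : R -> R.

(** The value [n] is minus the limit. It is a natural number because every quantity tropicalized
    below is a multiplicity. *)
Definition tropical f (n : nat) :=
  (forall e, 0 < e -> 0 < f e) /\ (fun e => e * ln (f e)) @ at_right (0 : R) --> (- n%:R : R).

Lemma cvg_eq_right (f g : R -> R) (l : R) :
  (forall e, 0 < e -> f e = g e) -> f @ at_right (0 : R) --> l -> g @ at_right (0 : R) --> l.
Proof.
move=> fg fl; apply: cvg_trans fl; apply: near_eq_cvg; near=> e.
by apply: fg; near: e; exact: nbhs_right_gt.
Unshelve. all: by end_near. Qed.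

Lemma cvg_maxr (f g : R -> R) (l m : R) :
  f @ at_right (0 : R) --> l -> g @ at_right (0 : R) --> m ->
  (fun e => Num.max (f e) (g e)) @ at_right (0 : R) --> Num.max l m.
Proof.
move=> fl gm; rewrite maxr_absE.
under eq_fun do rewrite maxr_absE.
apply: cvgMl; apply: cvgD; first exact: cvgD.
by apply: cvg_norm; apply: cvgB.
Qed.

Lemma tropical_exp n : tropical (fun e => expR (- n%:R / e)) n.
Proof.
split=> [e _|]; first exact: expR_gt0.
apply: (@cvg_eq_right (cst (- n%:R))); last exact: cvg_cst.
by move=> e e0; rewrite expRK mulrC divfK ?gt_eqF.
Qed.

Lemma tropicalM f g n m : tropical f n -> tropical g m -> tropical (fun e => f e * g e) (n + m).
Proof.
move=> [f0 fl] [g0 gl]; split=> [e e0|]; first by rewrite mulr_gt0 ?f0 ?g0.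
apply: (@cvg_eq_right (fun e => e * ln (f e) + e * ln (g e))).
  by move=> e e0; rewrite lnM ?posrE ?f0 ?g0 // mulrDr.
by rewrite natrD opprD; apply: cvgD.
Qed.

(** Logarithms turn the quotient into a difference; [m <= n] makes the natural-number subtraction
    agree with the real one. *)
Lemma tropical_div f g n m : (m <= n)%N ->
  tropical f n -> tropical g m -> tropical (fun e => f e / g e) (n - m).
Proof.
move=> mn [f0 fl] [g0 gl]; split=> [e e0|]; first by rewrite divr_gt0 ?f0 ?g0.
apply: (@cvg_eq_right (fun e => e * ln (f e) - e * ln (g e))).
  by move=> e e0; rewrite ln_div ?posrE ?f0 ?g0 // mulrBr.
rewrite natrB // opprB addrC -[m%:R]opprK; exact: cvgB.
Qed.

(** Squeeze: [f + g] lies between the maximum of [f] and [g] and twice that maximum, and the error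
    [e * ln 2] tends to 0. The maximum of the negated values is minus their minimum. *)
Lemma tropicalD f g n m : tropical f n -> tropical g m ->
  tropical (fun e => f e + g e) (minn n m).
Proof.
move=> [f0 fl] [g0 gl]; split=> [e e0|]; first by rewrite addr_gt0 ?f0 ?g0.
have -> : - (minn n m)%:R = Num.max (- n%:R) (- m%:R) :> R.
  by rewrite natr_min oppr_min.
have fg := cvg_maxr fl gl.
have hup : (fun e => e * ln 2 + Num.max (e * ln (f e)) (e * ln (g e))) @ at_right (0 : R)
    --> Num.max (- n%:R) (- m%:R : R).
  rewrite -[X in _ --> X]add0r; apply: cvgD => //.
  rewrite -[X in _ --> X](mul0r (ln 2)); apply: cvgMl.
  by apply: cvg_at_right_filter; exact: cvg_id.
apply: squeeze_cvgr fg hup; near=> e.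
have e0 : 0 < e by near: e; exact: nbhs_right_gt.
have [fe ge] := (f0 e e0, g0 e e0).
rewrite ge_max !ler_pM2l // !ler_ln ?posrE ?addr_gt0 // lerDl lerDr (ltW fe) (ltW ge) /=.
have [lefg|ltgf] := leP (f e) (g e).
  rewrite max_r; last by rewrite ler_pM2l // ler_ln ?posrE.
  by rewrite -mulrDr -lnM ?posrE // ler_pM2l // ler_ln ?posrE ?mulr_gt0 ?addr_gt0 //; lra.
rewrite max_l; last by rewrite ler_pM2l // ler_ln ?posrE // ltW.
by rewrite -mulrDr -lnM ?posrE // ler_pM2l // ler_ln ?posrE ?mulr_gt0 ?addr_gt0 //; lra.
Unshelve. all: by end_near. Qed.

End Tropical.

(** * Uniqueness of the factorization and the exchange relation *)

Section Factorization.
Variable R : realType.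
Implicit Types (X Y V v : nat -> R) (Ys : seq (nat -> R)).

(** The action of [Fkmx k V] on a column vector; matrix products become compositions of such maps,
    applied to unit vectors to obtain columns. *)
Definition Fk_apply (k : nat) V v : nat -> R :=
  fun a => v a - (if (k < a)%N then V (a - k)%N * v a.-1 else 0).

Lemma mulinf_Fkmx k V (A : infmx R) a c : (0 < k)%N -> (0 < a)%N ->
  mulinf (Fkmx k V) A a c = Fk_apply k V (A ^~ c) a.
Proof.
move=> k0 a0; rewrite /mulinf /Fk_apply big_nat_recr //=.
have -> : Fkmx k V a a = 1.
  by rewrite /Fkmx /Fmx eqxx; case: ifP => // _; rewrite eqxx.
rewrite mul1r addrC; congr (_ + _).
case: ltnP => [ka|ak]; last first.
  rewrite oppr0 big_nat big1 // => d /andP[d0 da].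
  rewrite /Fkmx (_ : (a < k) || (d < k))%N; last by lia.
  by rewrite gtn_eqF // mul0r.
case: a a0 ka => [//|[|a]] _ ka; first by lia.
rewrite big_nat_recr //= big_nat big1 => [|d /andP[d0 da]]; last first.
  rewrite /Fkmx /Fmx gtn_eqF; last by lia.
  case: ifP => h; first by rewrite mul0r.
  by rewrite !ifN ?mul0r //; lia.
rewrite add0r /Fkmx /Fmx.
rewrite (_ : (a.+2 < k) || (a.+1 < k) = false)%N; last by lia.
rewrite ifN ?ifT; [|lia|lia].
by rewrite mulNr; congr (- (V _ * _)); lia.
Qed.

Lemma eq_Fk_apply k V v v' : (0 < k)%N -> (forall a, (0 < a)%N -> v a = v' a) ->
  forall a, (0 < a)%N -> Fk_apply k V v a = Fk_apply k V v' a.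
Proof.
move=> k0 vv a a0; rewrite /Fk_apply vv //; case: ltnP => // ka.
by rewrite vv //; lia.
Qed.

Definition unit_vec (c : nat) : nat -> R := fun a => (a == c)%:R.

Lemma prodinf_Fkmx (I : Type) (s : seq I) (k : I -> nat) (V : I -> nat -> R) a c :
  all (fun i => (0 < k i)%N) s -> (0 < a)%N ->
  prodinf [seq Fkmx (k i) (V i) | i <- s] a c =
  foldr (fun i => Fk_apply (k i) (V i)) (unit_vec c) s a.
Proof.
elim: s a => [//|i s IH] a /= /andP[k0 ks] a0.
by rewrite mulinf_Fkmx //; apply: eq_Fk_apply => // d d0; exact: IH.
Qed.

Lemma prodinf_Fmx (I : Type) (s : seq I) (V : I -> nat -> R) a c :
  (0 < a)%N -> (0 < c)%N ->
  prodinf [seq Fmx (V i) | i <- s] a c =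
  foldr (fun i => Fk_apply 1 (V i)) (unit_vec c) s a.
Proof.
move=> a0 c0; rewrite -(@prodinf_Fkmx _ s (fun=> 1%N)) ?all_predT //.
elim: s a a0 => [//|i s IH] a a0 /=.
rewrite /mulinf; apply: eq_big_nat => d /andP[d0 da]; rewrite IH //; congr (_ * _).
rewrite /Fkmx (_ : (a < 1) || (d < 1) = false)%N; last by lia.
by rewrite !subn1 !prednK.
Qed.

(* [rows_apply k [:: Y_1; ...; Y_r]] is the action of
   [F_{k+r-1}(Y_r) ... F_k(Y_1)] on column vectors. *)
Fixpoint rows_apply (k : nat) Ys v : nat -> R :=
  if Ys is Y :: Ys' then rows_apply k.+1 Ys' (Fk_apply k Y v) else v.

Lemma rows_applyB k Ys v v' (b : R) a :
  rows_apply k Ys (fun a => v a - b * v' a) a = rows_apply k Ys v a - b * rows_apply k Ys v' a.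
Proof.
elim: Ys k v v' => [//|Y Ys IH] k v v' /=; rewrite -IH; congr rows_apply.
by apply/funext => d; rewrite /Fk_apply; case: ifP => _; ring.
Qed.

Lemma Fk_apply_unit_vec k Y c : (k <= c)%N ->
  Fk_apply k Y (unit_vec c) = fun a => unit_vec c a - Y (c.+1 - k)%N * unit_vec c.+1 a.
Proof.
move=> kc; apply/funext => a; rewrite /Fk_apply /unit_vec.
case: (ltnP k a) => ka; last by rewrite (_ : a == c.+1 = false) ?mulr0 //; lia.
case: (a =P c.+1) => [->|ac]; first by rewrite eqxx.
by rewrite (_ : a.-1 == c = false) ?mulr0 //; lia.
Qed.

Lemma Fk_apply_unit_vec_lt k Y c : (c < k)%N ->
  Fk_apply k Y (unit_vec c) = unit_vec c.
Proof.
move=> ck; apply/funext => a; rewrite /Fk_apply /unit_vec.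
case: (ltnP k a) => ka; last by rewrite subr0.
by rewrite (_ : a.-1 == c = false) ?mulr0 ?subr0 //; lia.
Qed.

Lemma rows_apply_unit_vec_lt k Ys c : (c < k)%N ->
  rows_apply k Ys (unit_vec c) = unit_vec c.
Proof.
elim: Ys k => [//|Y Ys IH] k ck /=.
by rewrite Fk_apply_unit_vec_lt // IH //; lia.
Qed.

(** Every factor is lower triangular with unit diagonal, so the leading entry of a column
    survives. *)
Lemma rows_apply_lower k Ys v c : (forall a, (a < c)%N -> v a = 0) ->
  (forall a, (a < c)%N -> rows_apply k Ys v a = 0) /\ rows_apply k Ys v c = v c.
Proof.
elim: Ys k v => [|Y Ys IH] k v v0 //=.
have [|h ->] := IH k.+1 (Fk_apply k Y v).
  move=> a ac; rewrite /Fk_apply v0 // v0 ?mulr0 ?if_same ?subr0 //; lia.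
split=> //; rewrite /Fk_apply; case: ltnP => kc; last by rewrite subr0.
by rewrite (v0 c.-1) ?mulr0 ?subr0 //; lia.
Qed.

Lemma rows_apply_diag k Ys c : rows_apply k Ys (unit_vec c) c = 1.
Proof.
have [|_ ->] := @rows_apply_lower k Ys (unit_vec c) c; last by rewrite /unit_vec eqxx.
by move=> a ac; rewrite /unit_vec ltn_eqF.
Qed.

(* Comparing columns [c = k, k+1, ...] in turn: column [c] of the product is
   column [c] minus [Y_{c+1-k}] times column [c+1] of the product without the
   last factor, and the latter column has a [1] in row [c+1]. *)
Lemma rows_apply_inj k Ys Ys' : (0 < k)%N -> size Ys = size Ys' ->
  (forall j i, (j < size Ys)%N -> (0 < i)%N -> nth (fun=> 0) Ys j i != 0) ->
  (forall a c, (0 < a)%N -> (0 < c)%N ->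
     rows_apply k Ys (unit_vec c) a = rows_apply k Ys' (unit_vec c) a) ->
  forall j i, (j < size Ys)%N -> (0 < i)%N ->
    nth (fun=> 0) Ys j i = nth (fun=> 0) Ys' j i.
Proof.
elim: Ys Ys' k => [//|Y Ys IH] [//|Y' Ys'] k k0 /= [ss] Yn0 eqP.
pose A c := rows_apply k.+1 Ys (unit_vec c).
pose A' c := rows_apply k.+1 Ys' (unit_vec c).
have step c : (k <= c)%N -> (forall a, (0 < a)%N -> A c a = A' c a) ->
    Y (c.+1 - k)%N = Y' (c.+1 - k)%N /\ (forall a, (0 < a)%N -> A c.+1 a = A' c.+1 a).
  move=> kc hA.
  have E a : (0 < a)%N -> Y (c.+1 - k)%N * A c.+1 a = Y' (c.+1 - k)%N * A' c.+1 a.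
    move=> a0; have := eqP a c a0 (leq_trans k0 kc).
    rewrite !Fk_apply_unit_vec // !rows_applyB -/(A c a) -/(A' c a) hA //.
    by move=> /addrI/oppr_inj.
  have EY : Y (c.+1 - k)%N = Y' (c.+1 - k)%N.
    (* Row [c.+1] of [E], where both columns have a 1, isolates the coefficients. *)
    by have := E c.+1 isT; rewrite /A /A' !rows_apply_diag !mulr1.
  split=> // a a0; have := E a a0; rewrite -EY => /mulfI; apply.
  by apply: (Yn0 0%N); lia.
have hA c a : (0 < a)%N -> (0 < c)%N -> A c a = A' c a.
  move=> a0 c0; case: (ltnP c k) => ck.
    by rewrite /A /A' !rows_apply_unit_vec_lt //; lia.
  (* The induction starts at column [k], which the remaining factors, of index above [k], leave
     fixed. *)
  rewrite -(subnKC ck); elim: (c - k)%N a a0 => [|n IHn] a a0.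
    by rewrite addn0 /A /A' !rows_apply_unit_vec_lt.
  by rewrite addnS; apply: (step _ _ IHn).2 => //; lia.
case=> [|j] i /= jn i0.
  have [] := step (k + i.-1)%N; [lia| |]; first by move=> a a0; apply: hA => //; lia.
  by rewrite (_ : _ - k = i)%N; last by lia.
apply: (IH _ k.+1) => // [j' i' j'n|a c a0 c0]; [exact: (Yn0 j'.+1 i' j'n)|exact: hA].
Qed.

(** Both sides are combinations of [v a], [v a.-1] and [v a.-2]. The hypotheses equate the
    coefficients on the first subdiagonal (its top entry separately) and on the second. *)
Lemma Fk_apply_exchange k X Y X' Y' v : (0 < k)%N ->
  Y' 1%N = Y 1%N + X 1%N ->
  (forall i, (0 < i)%N -> Y' i.+1 + X' i = Y i.+1 + X i.+1) ->
  (forall i, (0 < i)%N -> X' i * Y' i = Y i.+1 * X i) ->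
  Fk_apply k Y (Fk_apply k X v) = Fk_apply k.+1 X' (Fk_apply k Y' v).
Proof.
move=> k0 E1 E2 E3; apply/funext => a; rewrite /Fk_apply.
case: (ltnP k a) => ka; last by rewrite (_ : (k.+1 < a)%N = false) //; lia.
case: (ltnP k.+1 a) => ka1; last first.
  have -> : a = k.+1 by lia.
  by rewrite ltnn subSnn E1; ring.
have -> : (k < a.-1)%N by lia.
have [i [i0 ai]] : exists i, (0 < i)%N /\ a = (k.+1 + i)%N by exists (a - k.+1)%N; lia.
have -> : (a - k)%N = i.+1 by lia.
have -> : (a - k.+1)%N = i by lia.
have -> : (a.-1 - k)%N = i by lia.
have -> : v a - X i.+1 * v a.-1 - Y i.+1 * (v a.-1 - X i * v a.-2) =
  v a - (Y i.+1 + X i.+1) * v a.-1 + (Y i.+1 * X i) * v a.-2 by ring.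
by rewrite -E2 // -E3 //; ring.
Qed.

End Factorization.
(** * The subtraction-free action and its tropicalization *)

Section Geometric.
Variable R : realType.
Implicit Types (Y X : R -> nat -> R) (Ys : seq (R -> nat -> R)) (C x : seq nat).

(** The quantity Z of the recursion, with index shifted by one. Grouping Z / (X + Z) as one quotient
    makes it tropicalize to Z - min(X, Z), which is never negative. *)
Fixpoint geom_carrier Y X (n : nat) (e : R) : R :=
  if n is n'.+1 then Y e n'.+2 * (geom_carrier Y X n' e / (X e n'.+1 + geom_carrier Y X n' e))
  else Y e 1%N.

Definition geom_circled Y X : R -> nat -> R := fun e i => X e i + geom_carrier Y X i.-1 e.
Definition geom_boxed Y X : R -> nat -> R :=
  fun e i => Y e i.+1 * (X e i / (X e i + geom_carrier Y X i.-1 e)).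

Fixpoint geom_act Ys X : seq (R -> nat -> R) :=
  if Ys is Y :: Ys' then geom_circled Y X :: geom_act Ys' (geom_boxed Y X) else [:: X].

(** * Tropicalization of the geometric action *)

Definition tropical_row Y C :=
  forall i, (0 < i)%N -> tropical (fun e => Y e i) (count_mem i C).

Lemma tropical_geom_carrier Y X C x n : tropical_row Y C -> tropical_row X x ->
  tropical (geom_carrier Y X n) (carrier (fun k => count_mem k C) (fun k => count_mem k x) n).
Proof.
move=> YC Xx; elim: n => [|n IH] /=; first exact: YC.
apply: tropicalM; first exact: YC.
apply: tropical_div => //; first exact: geq_minr.
by apply: tropicalD => //; exact: Xx.
Qed.

Lemma tropical_bbs_step Y X C x : tropical_row Y C -> tropical_row X x ->
  tropical_row (geom_circled Y X) (bbs_step C x).1 /\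
  tropical_row (geom_boxed Y X) (bbs_step C x).2.
Proof.
move=> YC Xx; split=> i i0.
  rewrite (count_bbs_step C x i0).1.
  by apply: tropicalD; [exact: Xx|exact: tropical_geom_carrier].
rewrite (count_bbs_step C x i0).2 /boxed_out.
apply: tropicalM; first exact: YC.
apply: tropical_div; [exact: geq_minl|exact: Xx|].
by apply: tropicalD; [exact: Xx|exact: tropical_geom_carrier].
Qed.

Definition tropical_rows Ys (Cs : seq (seq nat)) :=
  size Ys = size Cs /\
  forall j, (j < size Cs)%N -> tropical_row (nth (fun _ _ => 0) Ys j) (nth [::] Cs j).

Lemma tropical_rows_cons Y Ys C Cs :
  tropical_rows (Y :: Ys) (C :: Cs) <-> tropical_row Y C /\ tropical_rows Ys Cs.
Proof.
split=> [[/= [sz] H]|[YC [sz H]]].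
  by split; [exact: (H 0%N)|split=> // j; exact: (H j.+1)].
by split=> [/=|[|j]]; [rewrite sz|move=> _; exact: YC|exact: H].
Qed.

Lemma tropical_geom_act Ys X Cs x : tropical_rows Ys Cs -> tropical_row X x ->
  tropical_rows (geom_act Ys X) (act Cs x).
Proof.
elim: Ys Cs X x => [|Y Ys IH] [|C Cs] X x; try by case.
  by move=> _ Xx; split=> // -[|].
move=> /tropical_rows_cons[YC YCs] Xx; have [h1 h2] := tropical_bbs_step YC Xx.
by apply/tropical_rows_cons; split=> //; exact: IH.
Qed.

Lemma tropical_foldl_geom_act (I : Type) Ys Cs (X : I -> R -> nat -> R)
    (x : I -> seq nat) (s : seq I) :
  tropical_rows Ys Cs -> (forall i, tropical_row (X i) (x i)) ->
  tropical_rows (foldl geom_act Ys [seq X i | i <- s]) (foldl act Cs [seq x i | i <- s]).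
Proof.
move=> + Xx; elim: s Ys Cs => [//|i s IH] Ys Cs YC /=.
by apply: IH; exact: tropical_geom_act.
Qed.

(** * Positivity of the rows and the factorization they give *)

Definition positive_row (Y : R -> nat -> R) e := forall i, (0 < i)%N -> 0 < Y e i.

Lemma geom_carrier_gt0 Y X e n : positive_row Y e -> positive_row X e -> 0 < geom_carrier Y X n e.
Proof.
move=> Y0 X0; elim: n => [|n IH] /=; first exact: Y0.
by rewrite mulr_gt0 ?Y0 // divr_gt0 // addr_gt0 ?X0.
Qed.

Lemma geom_circled_gt0 Y X e : positive_row Y e -> positive_row X e ->
  positive_row (geom_circled Y X) e.
Proof. by move=> Y0 X0 i i0; rewrite addr_gt0 ?X0 ?geom_carrier_gt0. Qed.

Lemma geom_boxed_gt0 Y X e : positive_row Y e -> positive_row X e ->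
  positive_row (geom_boxed Y X) e.
Proof.
move=> Y0 X0 i i0.
by rewrite mulr_gt0 ?Y0 // divr_gt0 ?X0 // addr_gt0 ?X0 ?geom_carrier_gt0.
Qed.

Lemma geom_act_gt0 Ys X e :
  (forall j, (j < size Ys)%N -> positive_row (nth (fun _ _ => 0) Ys j) e) ->
  positive_row X e ->
  forall j, (j < size (geom_act Ys X))%N -> positive_row (nth (fun _ _ => 0) (geom_act Ys X) j) e.
Proof.
elim: Ys X => [|Y Ys IH] X Ys0 X0 [|j] //= jn.
  by apply: geom_circled_gt0 => //; exact: (Ys0 0%N).
apply: IH => // [k kn|]; first exact: (Ys0 k.+1).
by apply: geom_boxed_gt0 => //; exact: (Ys0 0%N).
Qed.

(** The exchange relation moves the factor of [X] past the first row and raises its index to [k.+1];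
    the induction hypothesis carries it through the remaining rows. *)
Lemma rows_apply_geom_act k Ys X e v : (0 < k)%N ->
  (forall j, (j < size Ys)%N -> positive_row (nth (fun _ _ => 0) Ys j) e) ->
  positive_row X e ->
  rows_apply k [seq Y e | Y <- geom_act Ys X] v =
  rows_apply k [seq Y e | Y <- Ys] (Fk_apply k (X e) v).
Proof.
elim: Ys k X v => [//|Y Ys IH] k X v k0 Ys0 X0 /=.
have Y0 : positive_row Y e := Ys0 0%N isT.
rewrite IH //; first last.
- exact: geom_boxed_gt0.
- by move=> j jn; exact: (Ys0 j.+1).
congr rows_apply; apply/esym/Fk_apply_exchange => //.
- by rewrite /geom_circled addrC.
(* The fractions Z / (X + Z) and X / (X + Z) add up to 1, so the two multiples of the next [Y] entry
   recombine. *)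
- move=> i i0; rewrite /geom_circled /geom_boxed; case: i i0 => // i _ /=.
  have h : X e i.+1 + geom_carrier Y X i e != 0.
    by rewrite gt_eqF // addr_gt0 ?X0 ?geom_carrier_gt0.
  by field.
- move=> i i0; rewrite /geom_circled /geom_boxed -mulrA divfK //.
  by rewrite gt_eqF // addr_gt0 ?X0 ?geom_carrier_gt0.
Qed.

Lemma rows_apply_foldl_geom_act (I : Type) Ys (X : I -> R -> nat -> R) (s : seq I) e v :
  (forall j, (j < size Ys)%N -> positive_row (nth (fun _ _ => 0) Ys j) e) ->
  (forall i, positive_row (X i) e) ->
  rows_apply 1 [seq Y e | Y <- foldl geom_act Ys [seq X i | i <- s]] v =
  rows_apply 1 [seq Y e | Y <- Ys] (foldr (fun i => Fk_apply 1 (X i e)) v s).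
Proof.
move=> Ys0 X0; elim: s Ys Ys0 => [//|i s IH] Ys Ys0 /=.
by rewrite IH; [rewrite rows_apply_geom_act|exact: geom_act_gt0].
Qed.

End Geometric.

(** * Identifying the given factorization with the constructed rows *)

Lemma rows_apply_foldr_rev (R : realType) (f : nat -> nat -> R) k n v :
  rows_apply k [seq f j | j <- iota k n] v =
  foldr (fun j => Fk_apply j (f j)) v (rev (iota k n)).
Proof.
by elim: n k v => [//|n IH] k v /=; rewrite IH rev_cons -cats1 foldr_cat.
Qed.

Theorem theorem3p4 (R : realType) (W : nat -> nat -> nat) (b : nat -> nat) :
  (forall i j : nat, (b j < i)%N -> W i j = 0%N) ->
  exists N0 : nat, forall N : nat, (N0 <= N)%N ->
  forall U : R -> nat -> nat -> R,
    (forall eps : R, 0 < eps -> forall i j : nat,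
        (1 <= i)%N -> (1 <= j <= N.+1)%N -> 0 < U eps i j) ->
    (forall eps : R, 0 < eps -> forall a c : nat, (1 <= a)%N -> (1 <= c)%N ->
        prodinf [seq Fmx (fun i => expR (- (W i j)%:R / eps)) | j <- rev (iota 0 N.+1)] a c
        = prodinf [seq Fkmx k (fun i => U eps i k) | k <- rev (iota 1 N.+1)] a c) ->
    forall i j : nat, (1 <= i)%N -> (1 <= j <= N.+1)%N ->
      (fun eps : R => eps * ln (U eps i j)) @ at_right (0 : R)
        --> (- (count_mem i (nth [::] (circled_array W b N) j.-1))%:R : R).
Proof.
(* The bound 0 works: each action adds one row, so for every [N] the array has [N.+1] rows, matching
   the factors [U]. *)
move=> Wb; exists 0%N => N _ U U0 eqU i j i0 jN.
pose V j : R -> nat -> R := fun e i => expR (- (W i j)%:R / e).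
pose G := foldl (@geom_act R) [::] [seq V j | j <- rev (iota 0 N.+1)].
have V0 j' e : positive_row (V j') e by move=> k _; exact: expR_gt0.
have Vrow j' : tropical_row (V j') (one_row W (b j') j').
  move=> k k0; rewrite count_one_row // => [|k' kb]; last exact: Wb.
  exact: tropical_exp.
have GC : tropical_rows G (circled_array W b N).
  exact: (@tropical_foldl_geom_act _ _ [::] [::]).
have szG : size G = N.+1.
  suff sz Ys Xs : size (foldl (@geom_act R) Ys Xs) = (size Ys + size Xs)%N.
    by rewrite /G sz size_map size_rev size_iota.
  elim: Xs Ys => [|X Xs IH] Ys /=; first by rewrite addn0.
  rewrite IH addnS -addSn; congr (_ + _)%N.
  by elim: Ys X {IH} => //= Y Ys IH X; rewrite IH.
(* At each fixed [e] both families factor the same product, and positivity of [U] gives the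
   nonvanishing that uniqueness requires. Rows are numbered from 1 but stored from position 0, hence
   [j.-1]. *)
have UG e : 0 < e -> U e i j = nth (fun _ _ => 0) G j.-1 e i.
  move=> e0; pose Us := [seq (fun i => U e i k) | k <- iota 1 N.+1].
  have nthUs k : (k < N.+1)%N -> nth (fun=> 0) Us k = fun i => U e i k.+1.
    by move=> kN; rewrite (nth_map 0%N) ?size_iota // nth_iota.
  have -> : U e i j = nth (fun=> 0) Us j.-1 i.
    by rewrite nthUs; [congr U|]; lia.
  rewrite -(nth_map _ (fun=> 0) (fun Y => Y e)) ?szG; last by lia.
  apply: (@rows_apply_inj _ 1) => //.
  - by rewrite !size_map size_iota szG.
  - move=> j' i'; rewrite size_map size_iota => jN' i0'.
    by rewrite nthUs // gt_eqF // U0.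
  - move=> a c a0 c0; have := eqU e e0 a c a0 c0.
    rewrite prodinf_Fmx // prodinf_Fkmx //; last first.
      by rewrite all_rev; apply/allP => k; rewrite mem_iota => /andP[].
    (* [rows_apply] applies the factor of index 1 first, and that factor stands rightmost in the
       product, whence the reversed list. *)
    rewrite (rows_apply_foldr_rev (fun k i => U e i k)) => <-.
    by rewrite rows_apply_foldl_geom_act.
  - by rewrite size_map size_iota; lia.
have jC : (j.-1 < size (circled_array W b N))%N by rewrite -GC.1 szG; lia.
have [_ lim] := GC.2 _ jC i i0.
apply: cvg_eq_right lim => e e0; by rewrite UG.
Qed.
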